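(* Let $f\in\mathbb{C}[x_0,\ldots,x_n]_d$ be a form, let $A=Q/\operatorname{Ann}(f)$ be the associated Artinian Gorenstein algebra and $a_k=\dim A_k$. Suppose that $f$ has a power sum decomposition $f=l_1^d+\cdots+l_s^d$ (with $l_i$ linear forms) with $s=a_k$ for some $k\le d/2$. Then $\operatorname{hess}_f^k\neq 0$. In particular, if $d=2q+1$ and $k=q$, then $A$ has the Weak Lefschetz property.
   Context: $Q=\mathbb{C}[X_0,\ldots,X_n]$ acts on $\mathbb{C}[x_0,\ldots,x_n]$ by $X_i=\partial/\partial x_i$; $\operatorname{Ann}(f)=\{\alpha\in Q:\alpha(f)=0\}$ and $A=Q/\operatorname{Ann}(f)=\bigoplus_{i=0}^d A_i$. $\operatorname{hess}_f^k=\det[\alpha_i\alpha_j(f)]_{i,j}$, where $(\alpha_1,\ldots,\alpha_{a_k})$ is a basis of $A_k$ (the vanishing or not of this polynomial does not depend on the basis). $A$ has the Weak Lefschetz property (WLP) if there is $L\in A_1$ such that the multiplication maps $\bullet L:A_i\to A_{i+1}$ have maximal rank for all $i=0,\ldots,d$. *)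

(* Defs.v *)
From HB Require Import structures.
From mathcomp Require Import all_boot all_order all_algebra.
From mathcomp Require Import ssrcomplements mpoly complex reals.

Set Implicit Arguments.
Unset Strict Implicit.
Unset Printing Implicit Defensive.

Import GRing.Theory.
Local Open Scope ring_scope.
Local Open Scope quotient_scope.

Section Action.
Variables (K : fieldType) (n : nat).
Local Notation Q := {mpoly K[n.+1]}.
Implicit Types (a b f g : Q) (m : 'X_{1..n.+1}).

(* The action of a differential operator a, X_i acting as the i-th partial
   derivative: 'X_[m] acts on f as the iterated derivative f^`M[m]. *)
Definition diffact a f : Q := \sum_(m <- msupp a) a@_m *: f^`M[m].

Lemma diffactwE k a f : (msize a <= k)%N ->
  diffact a f = \sum_(m : 'X_{1..n.+1 < k}) a@_m *: f^`M[m].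
Proof.
move=> le_ak; rewrite /diffact (big_mksub 'X_{1..n.+1 < k}) //=.
- rewrite big_rmcond //= => m /memN_msupp_eq0 ->.
  by rewrite scale0r.
- exact: msupp_uniq.
by move=> m /msize_mdeg_lt /leq_trans; apply.
Qed.

Lemma diffact_is_linear f : linear (diffact^~ f).
Proof.
move=> c a b; pose k := maxn (msize (c *: a + b)) (maxn (msize a) (msize b)).
rewrite !(@diffactwE k) ?leq_max ?leqnn ?orbT //.
rewrite scaler_sumr -big_split /=; apply: eq_bigr => m _.
by rewrite mcoeffD mcoeffZ scalerDl scalerA.
Qed.

Definition diffactr f a := diffact a f.

HB.instance Definition _ f :=
  GRing.isLinear.Build K Q Q _ (diffactr f) (diffact_is_linear f).

Lemma diffactD f : {morph diffact^~ f : a b / a + b}.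
Proof. exact: (linearD (diffactr f)). Qed.

Lemma diffactB f : {morph diffact^~ f : a b / a - b}.
Proof. exact: (linearB (diffactr f)). Qed.

Lemma diffact0 f : diffact 0 f = 0.
Proof. exact: (linear0 (diffactr f)). Qed.

Lemma diffactZ f c : {morph diffact^~ f : a / c *: a}.
Proof. by move=> a; rewrite -!/(diffactr f _) linearZ. Qed.

Lemma diffact_sum f I (r : seq I) (P : pred I) (F : I -> Q) :
  diffact (\sum_(i <- r | P i) F i) f = \sum_(i <- r | P i) diffact (F i) f.
Proof. exact: (linear_sum (diffactr f)). Qed.

Lemma diffactX m f : diffact 'X_[m] f = f^`M[m].
Proof. by rewrite /diffact msuppX big_seq1 mcoeffX eqxx scale1r. Qed.

Lemma diffact_is_linear_r a : linear (diffact a).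
Proof.
move=> c f g; rewrite /diffact scaler_sumr -big_split /=.
apply: eq_bigr => m _.
by rewrite linearP scalerDr !scalerA [c * _]mulrC.
Qed.

HB.instance Definition _ a :=
  GRing.isLinear.Build K Q Q _ (diffact a) (diffact_is_linear_r a).

Lemma diffactM a b f : diffact (a * b) f = diffact a (diffact b f).
Proof.
have DX m c : diffact ('X_[m] * c) f = diffact 'X_[m] (diffact c f).
  rewrite [c]mpolyE mulr_sumr !diffact_sum linear_sum /=.
  apply: eq_bigr => m' _; rewrite -scalerAr !diffactZ linearZ /=.
  by rewrite -mpolyXD !diffactX addmC mderivmDm.
rewrite {1}[a]mpolyE [in RHS](mpolyE a) mulr_suml !diffact_sum.
by apply: eq_bigr => m _; rewrite -scalerAl !diffactZ DX.
Qed.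

Lemma diffact1 f : diffact 1 f = f.
Proof. by rewrite -mpolyX0 diffactX mderivm0m. Qed.

Lemma mderivm_out m f : (msize f <= mdeg m)%N -> f^`M[m] = 0.
Proof.
move=> le_fm; apply/mpolyP => m'; rewrite mcoeff0 mcoeff_mderivm.
rewrite memN_msupp_eq0 ?mul0rn //; apply/negP => /msize_mdeg_lt.
by rewrite mdegD ltnNge (leq_trans le_fm) ?leq_addr.
Qed.

Lemma msize_mderivm m f : (msize f^`M[m] <= msize f)%N.
Proof.
rewrite msizeE; apply/bigmax_leqP_seq => m' m'f _.
have: (m + m')%MM \in msupp f.
  apply: contraLR m'f => /memN_msupp_eq0 fm.
  by rewrite mcoeff_msupp negbK mcoeff_mderivm fm mul0rn.
by move=> /msize_mdeg_lt; apply: leq_trans; rewrite mdegD ltnS leq_addl.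
Qed.

Lemma msize_diffact a f : (msize (diffact a f) <= msize f)%N.
Proof.
rewrite /diffact; elim/big_rec: _ => [|m p _ IH]; first by rewrite msize0.
apply: leq_trans (msizeD_le _ _) _; rewrite geq_max IH andbT.
exact: leq_trans (msizeZ_le _ _) (msize_mderivm _ _).
Qed.

End Action.

Section Algebra.
Variables (K : fieldType) (n : nat) (f : {mpoly K[n.+1]}).
Local Notation Q := {mpoly K[n.+1]}.

Definition Ann : {pred Q} := fun a => diffact a f == 0.

Lemma Ann_zmod_closed : zmod_closed Ann.
Proof.
split=> [|a b]; rewrite /in_mem /= /Ann.
  by rewrite diffact0.
by move=> /eqP a0 /eqP b0; rewrite diffactB a0 b0 subr0.
Qed.

HB.instance Definition _ := GRing.isZmodClosed.Build Q Ann Ann_zmod_closed.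

(* The algebra Q / Ann(f).  Since it is the zero ring when f = 0, only the
   additive group structure is inherited from the quotients of ring_quotient,
   whose ring structure requires a proper ideal. *)
Definition apolar_alg : Type := {ideal_quot Ann}.
Local Notation A := apolar_alg.

HB.instance Definition _ := GRing.Zmodule.on A.
HB.instance Definition _ := generic_quotient.Quotient.on A.

Definition apolar_pi (a : Q) : A := \pi_A a.

Lemma apolar_piP a b :
  reflect (diffact a f = diffact b f) (apolar_pi a == apolar_pi b).
Proof.
rewrite /apolar_pi -[_ == _](Quotient.idealrBE Ann a b) /in_mem /= /Ann.
by rewrite diffactB subr_eq0; apply: eqP.
Qed.

Lemma apolar_pi_eq a b :
  diffact a f = diffact b f -> apolar_pi a = apolar_pi b.
Proof. by move=> /apolar_piP/eqP. Qed.

Lemma apolar_reprK (x : A) : apolar_pi (repr x) = x.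
Proof. exact: reprK. Qed.

Lemma diffact_repr a : diffact (repr (apolar_pi a)) f = diffact a f.
Proof. by apply/apolar_piP; rewrite apolar_reprK. Qed.

Lemma apolar_piB : {morph apolar_pi : a b / a - b}.
Proof. exact: (raddfB (\pi_{ideal_quot Ann})). Qed.

Lemma apolar_piD : {morph apolar_pi : a b / a + b}.
Proof. exact: (raddfD (\pi_{ideal_quot Ann})). Qed.

Definition apolar_one : A := apolar_pi 1.
Definition apolar_mul (x y : A) : A := apolar_pi (repr x * repr y).
Definition apolar_scale (c : K) (x : A) : A := apolar_pi (c *: repr x).

Lemma apolar_piM (a b : Q) :
  apolar_pi (a * b) = apolar_mul (apolar_pi a) (apolar_pi b).
Proof.
apply: apolar_pi_eq; rewrite diffactM -(diffact_repr b) -diffactM mulrC.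
by rewrite [LHS]diffactM -(diffact_repr a) -diffactM mulrC.
Qed.

Lemma apolar_piZ c a : apolar_pi (c *: a) = apolar_scale c (apolar_pi a).
Proof.
apply: apolar_pi_eq.
by rewrite !diffactZ diffact_repr.
Qed.

Lemma apolar_mulA : associative apolar_mul.
Proof.
move=> x y z; rewrite -[x]apolar_reprK -[y]apolar_reprK -[z]apolar_reprK.
by rewrite -!apolar_piM mulrA.
Qed.

Lemma apolar_mulC : commutative apolar_mul.
Proof. by move=> x y; rewrite /apolar_mul mulrC. Qed.

Lemma apolar_mul1 : left_id apolar_one apolar_mul.
Proof. by move=> x; rewrite -[x]apolar_reprK -apolar_piM mul1r. Qed.

Lemma apolar_mulDl : left_distributive apolar_mul +%R.
Proof.
move=> x y z; rewrite -[x]apolar_reprK -[y]apolar_reprK -[z]apolar_reprK.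
by rewrite -apolar_piD -!apolar_piM -apolar_piD mulrDl.
Qed.

HB.instance Definition _ := GRing.Zmodule_isComPzRing.Build A
  apolar_mulA apolar_mulC apolar_mul1 apolar_mulDl.

Lemma apolar_scaleA a b v :
  apolar_scale a (apolar_scale b v) = apolar_scale (a * b) v.
Proof. by rewrite -[v]apolar_reprK -!apolar_piZ scalerA. Qed.

Lemma apolar_scale1 : left_id 1 apolar_scale.
Proof. by move=> v; rewrite -[v]apolar_reprK -apolar_piZ scale1r. Qed.

Lemma apolar_scaleDr : right_distributive apolar_scale +%R.
Proof.
move=> c x y; rewrite -[x]apolar_reprK -[y]apolar_reprK.
by rewrite -apolar_piD -!apolar_piZ -apolar_piD scalerDr.
Qed.

Lemma apolar_scaleDl v : {morph apolar_scale^~ v : a b / a + b}.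
Proof.
move=> a b; rewrite -[v]apolar_reprK.
by rewrite -!apolar_piZ -apolar_piD scalerDl.
Qed.

HB.instance Definition _ := GRing.Zmodule_isLmodule.Build K A
  apolar_scaleA apolar_scale1 apolar_scaleDr apolar_scaleDl.

Lemma apolar_pi_is_linear : linear apolar_pi.
Proof. by move=> c a b; rewrite apolar_piD apolar_piZ. Qed.

HB.instance Definition _ :=
  GRing.isLinear.Build K Q A _ apolar_pi apolar_pi_is_linear.

Lemma apolar_pi_is_monoid_morphism : monoid_morphism apolar_pi.
Proof. by split=> // a b; rewrite apolar_piM. Qed.

HB.instance Definition _ :=
  GRing.isMonoidMorphism.Build Q A apolar_pi apolar_pi_is_monoid_morphism.

(* Finite dimensionality of A: x |-> x(f) embeds A into the polynomials of
   degree at most deg f, and A is generated by the classes of the monomials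
   of degree at most deg f. *)
Local Notation I := ('X_{1..n.+1 < msize f}).

Definition apolar_coord (x : A) : 'rV[K]_#|{: I}| :=
  \row_i (diffact (repr x) f)@_(val (enum_val i)).

Lemma apolar_coord_pi a :
  apolar_coord (apolar_pi a) = \row_i (diffact a f)@_(val (enum_val i)).
Proof. by apply/rowP => i; rewrite !mxE diffact_repr. Qed.

Lemma apolar_coord_is_linear : linear apolar_coord.
Proof.
move=> c x y; rewrite -[x]apolar_reprK -[y]apolar_reprK -linearP.
rewrite !apolar_coord_pi; apply/rowP => i; rewrite !mxE.
by rewrite diffactD diffactZ mcoeffD mcoeffZ.
Qed.

HB.instance Definition _ :=
  GRing.isLinear.Build K A 'rV_#|{: I}| _ apolar_coord apolar_coord_is_linear.

Lemma apolar_coord_inj : injective apolar_coord.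
Proof.
move=> x y; rewrite -[x]apolar_reprK -[y]apolar_reprK !apolar_coord_pi.
move=> /rowP exy; apply: apolar_pi_eq; apply/mpolyP => m.
have [lt_m|le_m] := ltnP (mdeg m) (msize f).
  by have := exy (enum_rank (BMultinom lt_m)); rewrite !mxE enum_rankK.
rewrite !memN_msupp_eq0 //; apply/negP => /msize_mdeg_lt;
  by rewrite ltnNge (leq_trans (msize_diffact _ _)).
Qed.

Let M : 'M[K]_#|{: I}| :=
  \matrix_i apolar_coord (apolar_pi 'X_[val (enum_val i)]).

Let of_row (r : 'rV[K]_#|{: I}|) : A :=
  \sum_i r 0 i *: apolar_pi 'X_[val (enum_val i)].

Let of_rowE r : apolar_coord (of_row r) = r *m M.
Proof.
rewrite /of_row linear_sum mulmx_sum_row /=; apply: eq_bigr => i _.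
by rewrite linearZ rowK.
Qed.

Let apolar_coord_sub x : (apolar_coord x <= M)%MS.
Proof.
rewrite -[x]apolar_reprK [repr x]mpolyE linear_sum linear_sum /=.
apply: summx_sub => m _; rewrite !linearZ /=; apply: scalemx_sub.
have [lt_m|le_m] := ltnP (mdeg m) (msize f).
  have -> : m = val (enum_val (enum_rank (BMultinom lt_m))).
    by rewrite enum_rankK.
  by rewrite -(rowK (fun i => apolar_coord (apolar_pi 'X_[val (enum_val i)])))
     row_sub.
suff -> : apolar_pi 'X_[m] = 0 by rewrite linear0 sub0mx.
rewrite -(linear0 apolar_pi); apply: apolar_pi_eq.
by rewrite diffact0 diffactX mderivm_out.
Qed.

Lemma apolar_vecaxiom : Vector.axiom (\rank M) A.
Proof.
exists (fun x => apolar_coord x *m pinvmx (row_base M)) => [c x y|].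
  by rewrite linearP mulmxDl -scalemxAl.
exists (fun r => of_row (r *m row_base M *m pinvmx M)) => [x|r].
  apply: apolar_coord_inj; rewrite of_rowE mulmxKpV ?eq_row_base //.
  by rewrite mulmxKpV.
rewrite of_rowE mulmxKpV; last first.
  by apply: submx_trans (submxMl _ _) _; rewrite eq_row_base.
by apply: (row_free_inj (row_base_free M)); rewrite mulmxKpV // submxMl.
Qed.

HB.instance Definition _ := Lmodule_hasFinDim.Build K A apolar_vecaxiom.

(* A_i, the image in A of the space of forms of degree i. *)
Definition apolar_piece (i : nat) : {vspace A} :=
  limg (linfun (fun a : dhomog n.+1 K i => apolar_pi (mpoly_of_dhomog a))).

Lemma apolar_pieceP i (x : A) :
  reflect (exists2 a : Q, a \is i.-homog & x = apolar_pi a)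
          (x \in apolar_piece i).
Proof.
pose g (a : dhomog n.+1 K i) := apolar_pi (mpoly_of_dhomog a).
have g_lin : linear g by move=> c a b; rewrite /g !linearP.
pose gL := GRing.isLinear.Build K _ _ _ g g_lin.
pose gl : {linear dhomog n.+1 K i -> A} := HB.pack g gL.
apply: (iffP idP) => [/memv_imgP[a _ ->]|[a a_i ->]].
  by exists (mpoly_of_dhomog a); [case: a | rewrite (lfunE gl)].
apply/memv_imgP; exists (DHomog a_i); first exact: memvf.
by rewrite (lfunE gl).
Qed.

(* The action of A on f, through any representative (see diffact_repr). *)
Definition apolar_act (x : A) : Q := diffact (repr x) f.

Definition hessian_poly (r : nat) (alpha : r.-tuple A) : Q :=
  \det (\matrix_(i < r, j < r) apolar_act (tnth alpha i * tnth alpha j)).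

Lemma linfun_mulE (L x : A) : linfun ( *%R L) x = L * x.
Proof.
have L_lin : linear ( *%R L : A -> A).
  move=> c; elim/quotW => a; elim/quotW => b.
  rewrite -[L]apolar_reprK -![\pi _]/(apolar_pi _) -linearP -!rmorphM -linearP.
  by rewrite mulrDr scalerAr.
pose hL := GRing.isLinear.Build K _ _ _ ( *%R L : A -> A) L_lin.
pose h : {linear A -> A} := HB.pack ( *%R L : A -> A) hL.
exact: (lfunE h).
Qed.

(* The map A_i -> A_(i.+1), x |-> L * x, has maximal rank. *)
Definition mul_maxrank (L : A) (i : nat) : Prop :=
  \dim (linfun ( *%R L) @: apolar_piece i) =
    minn (\dim (apolar_piece i)) (\dim (apolar_piece i.+1)).

Definition weak_lefschetz (d : nat) : Prop :=
  exists2 L : A, L \in apolar_piece 1 &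
    forall i : nat, (i <= d)%N -> mul_maxrank L i.

End Algebra.

Arguments hessian_poly {K n} f {r} alpha.

(* Main.v *)
(* Let p_t be the point whose coordinates are the coefficients of l_t.  A form a
   of degree e acts on f = sum_t l_t^d by
     a(f) = d (d-1) ... (d-e+1) sum_t a(p_t) l_t^(d-e),
   so a form vanishing at the s points p_t kills f.  Hence, when s = a_k and the
   forms alpha_i represent a basis of A_k, the square matrix V = (alpha_i(p_t))
   is invertible.  The Hessian matrix is V D V^T up to a nonzero constant, D
   being the diagonal matrix of the l_t^(d-2k).  Moreover l_t = 0 is impossible
   for k < d: the nonzero combination of the alpha_i that vanishes at every
   other point (and is 1 at p_t) would kill f.
   For the weak Lefschetz property when 2k < d, any linear L nonvanishing at
   all the p_t works: multiplication by L multiplies the value at p_t by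
   L(p_t) != 0, and this makes it injective on A_i for i <= k and surjective
   onto A_(i+1) for i >= k. *)

Require Import Defs.
From mathcomp Require Import all_boot all_order all_algebra.
From mathcomp Require Import mpoly complex reals.

Local Open Scope ring_scope.

Set Implicit Arguments.
Unset Strict Implicit.
Unset Printing Implicit Defensive.

Import GRing.Theory.

(* Looking for [v] on the moment curve [(1, x, x^2, ...)] reduces the claim to
   finding a nonroot of a nonzero univariate polynomial. *)
Lemma exists_common_nonroot (K : fieldType) (n s : nat)
    (p : 'I_s -> 'I_n -> K) :
  has_char0 K -> (forall t, exists i, p t i != 0) ->
  exists v : 'I_n -> K, forall t, \sum_i p t i * v i != 0.
Proof.
move=> K0 p_neq0; pose g t : {poly K} := \sum_i p t i *: 'X^i.
have g_neq0 t : g t != 0.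
  have [i pti] := p_neq0 t; apply: contraNneq pti => /polyP/(_ i).
  rewrite coef0 coef_sum (bigD1 i) //= coefZ coefXn eqxx mulr1 => <-.
  rewrite big1 ?addr0 // => j ji.
  by rewrite coefZ coefXn eq_sym (inj_eq val_inj) (negPf ji) mulr0.
(* A nonzero polynomial has fewer roots than its size, and in characteristic 0 the first natural
   numbers are distinct. *)
have /hasP[x _ gx] : has (predC (root (\prod_t g t)))
    [seq j%:R | j <- iota 0 (size (\prod_t g t))].
  rewrite has_predC; apply/negP => /max_poly_roots.
  have -> : \prod_t g t != 0 by apply/prodf_neq0 => t _; apply: g_neq0.
  rewrite size_map size_iota ltnn => /(_ isT) /implyP; rewrite implybF.
  rewrite map_inj_uniq ?iota_uniq // => i j.
  wlog ij : i j / (i <= j)%N => [IH|/eqP].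
    by case/orP: (leq_total i j) => ij; [|move=> /esym]; move/(IH _ _ ij).
  rewrite eq_sym -subr_eq0 -natrB // (pcharf0P _).1 // subn_eq0 => ji.
  by apply/eqP; rewrite eqn_leq ij.
exists (fun i => x ^+ i) => t.
move: gx; rewrite /= rootE horner_prod => /prodf_neq0/(_ t isT).
rewrite /g horner_sum; congr (_ != 0).
by apply: eq_bigr => i _; rewrite hornerZ hornerXn.
Qed.

(** * Derivatives of powers of a linear form *)

Section LinearForm.
Variables (K : fieldType) (n : nat) (l : {mpoly K[n]}).
Hypothesis l_homog : l \is 1.-homog.

Let p i := l@_U_(i).

Lemma mderiv_linear_form i : l^`M(i) = (p i)%:MP.
Proof.
apply/mpolyP => m; rewrite mcoeff_deriv mcoeffC.
have [<-|m_neq0] := eqVneq 0%MM m; first by rewrite add0m mnm0E mulr1.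
rewrite (dhomog_nemf_coeff l_homog) ?mul0rn ?mulr0 //=.
by rewrite mdegD mdeg1 addn1 eqSS mdeg_eq0 eq_sym.
Qed.

Lemma mderiv_linear_form_exp e i :
  (l ^+ e)^`M(i) = (e%:R * p i) *: l ^+ e.-1.
Proof.
elim: e => [|e IH]; first by rewrite expr0 mul0r scale0r mderivC.
rewrite exprS mderivM IH mderiv_linear_form mul_mpolyC -scalerAr.
(* [l * l ^+ e.-1] is [l ^+ e] only for positive [e]; for [e = 0] the coefficient vanishes. *)
case: e {IH} => [|e]; first by rewrite !mul0r scale0r addr0 mul1r.
by rewrite -exprS -scalerDl -{1}[p i]mul1r -mulrDl nat1r.
Qed.

(** When [mdeg m > d] the falling factorial is 0, so the truncated exponent is harmless. *)
Lemma mderivm_linear_form_exp d m :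
  (l ^+ d)^`M[m] =
    ((d ^_ (mdeg m))%:R * 'X_[m].@[p]) *: l ^+ (d - mdeg m).
Proof.
(* Each variable [i] is listed [m i] times, which turns the iterated derivative into a fold of
   single ones. *)
pose r := flatten [seq nseq (m i) i | i <- enum 'I_n].
have foldr_mderiv s : foldr (@mderiv n K) (l ^+ d) s =
    ((d ^_ (size s))%:R * \prod_(i <- s) p i) *: l ^+ (d - size s).
  elim: s => [|i s IH] /=.
    by rewrite big_nil ffactn0 mulr1 scale1r subn0.
  rewrite {}IH mderivZ mderiv_linear_form_exp scalerA subnS big_cons.
  by rewrite ffactnSr natrM; congr (_ *: _); rewrite mulrACA [_ * p i]mulrC.
have size_r : size r = mdeg m.
  rewrite size_flatten /shape -map_comp sumnE big_map big_enum mdegE /=.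
  by apply: eq_bigr => i _; rewrite size_nseq.
rewrite mderivm_foldr -/r foldr_mderiv size_r mevalX.
congr (_ * _ *: _); rewrite big_flatten big_map big_enum /=.
by apply: eq_bigr => i _; rewrite big_nseq iter_mulr_1.
Qed.

End LinearForm.

Lemma diffact_linear_form_exp (K : fieldType) (n d e : nat)
    (l a : {mpoly K[n.+1]}) :
  l \is 1.-homog -> a \is e.-homog ->
  diffact a (l ^+ d) =
    ((d ^_ e)%:R * a.@[fun i => l@_U_(i)]) *: l ^+ (d - e).
Proof.
move=> l_homog /dhomogP a_homog; rewrite /diffact mevalE mulr_sumr scaler_suml.
rewrite big_seq [in RHS]big_seq; apply: eq_bigr => m /a_homog <-.
by rewrite mderivm_linear_form_exp // scalerA mevalX mulrCA.
Qed.

Lemma apolar_pi_eq0P (K : fieldType) (n : nat) (f a : {mpoly K[n.+1]}) :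
  apolar_pi f a = 0 <-> diffact a f = 0.
Proof.
rewrite -(linear0 (apolar_pi f)) -{2}(diffact0 f).
by split=> [/eqP/apolar_piP|/apolar_piP/eqP].
Qed.

(** * Forms acting on a sum of powers of linear forms *)

Section PowerSum.
Variables (K : fieldType) (n d s : nat) (l : 'I_s -> {mpoly K[n.+1]}).
Hypothesis K0 : has_char0 K.
Hypothesis l_homog : forall t, l t \is 1.-homog.

Let f := \sum_t l t ^+ d.
Let p t i := (l t)@_U_(i).
Local Notation A := (apolar_alg f).

Lemma diffact_power_sum e a : a \is e.-homog ->
  diffact a f = \sum_t ((d ^_ e)%:R * a.@[p t]) *: l t ^+ (d - e).
Proof.
move=> a_homog; rewrite linear_sum /=; apply: eq_bigr => t _.
exact: diffact_linear_form_exp.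
Qed.

Lemma apolar_pi_eval_eq0 e a : a \is e.-homog -> (forall t, a.@[p t] = 0) ->
  apolar_pi f a = 0.
Proof.
move=> a_homog ap; apply/apolar_pi_eq0P; rewrite (diffact_power_sum a_homog).
by rewrite big1 // => t _; rewrite ap mulr0 scale0r.
Qed.

Lemma natf_ffact_neq0 e : (e <= d)%N -> (d ^_ e)%:R != 0 :> K.
Proof. by move=> ed; rewrite (pcharf0P _).1 // -lt0n ffact_gt0. Qed.

(** * Evaluating a basis of [apolar_piece f k] at the points *)

Section Basis.
Variables (k : nat) (alpha : s.-tuple A).
Hypothesis alpha_free : free alpha.
Variable a : 'I_s -> {mpoly K[n.+1]}.
Hypothesis a_homog : forall i, a i \is k.-homog.
Hypothesis alphaE : forall i, tnth alpha i = apolar_pi f (a i).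

Let V := \matrix_(i, t) (a i).@[p t].

Lemma comb_homog (c : 'I_s -> K) : \sum_i c i *: a i \is k.-homog.
Proof. by apply: rpred_sum => i _; apply: rpredZ; apply: a_homog. Qed.

Lemma meval_comb (c : 'rV_s) t : (\sum_i c 0 i *: a i).@[p t] = (c *m V) 0 t.
Proof.
rewrite rmorph_sum mxE; apply: eq_bigr => i _.
by rewrite mxE /= mevalZ.
Qed.

Lemma apolar_pi_comb_eq0 (c : 'I_s -> K) :
  apolar_pi f (\sum_i c i *: a i) = 0 -> forall i, c i = 0.
Proof.
move=> c0; move/freeP: alpha_free; apply; rewrite -[RHS]c0 linear_sum /=.
by apply: eq_bigr => i _; rewrite linearZ /= -alphaE (tnth_nth 0).
Qed.

(** A row in the left kernel of [V] gives a form vanishing at all the points, hence zero in [A];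
    freeness of [alpha] then kills the row. *)
Lemma eval_mx_unit : V \in unitmx.
Proof.
rewrite -row_free_unit; apply: inj_row_free => c cV.
apply/rowP => i; rewrite [RHS]mxE; move: i.
apply: apolar_pi_comb_eq0; apply: apolar_pi_eval_eq0 (comb_homog _) _ => t.
by rewrite meval_comb cV mxE.
Qed.

(** Lagrange interpolation forms for the points [p t]. *)
Let b t := \sum_i (row t (invmx V)) 0 i *: a i.

Let meval_b t u : (b t).@[p u] = (t == u)%:R.
Proof. by rewrite meval_comb -row_mul mulVmx ?eval_mx_unit // !mxE. Qed.

Lemma exists_dual_forms : exists2 b : 'I_s -> {mpoly K[n.+1]},
  forall t, b t \is k.-homog & forall t u, (b t).@[p u] = (t == u)%:R.
Proof. by exists b => [t|]; [apply: comb_homog | apply: meval_b]. Qed.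

Lemma linear_form_neq0 t : (k < d)%N -> l t != 0.
Proof.
move=> lt_kd; apply/eqP => lt0.
have: apolar_pi f (b t) = 0.
  apply/apolar_pi_eq0P; rewrite (diffact_power_sum (comb_homog _)).
  rewrite big1 // => u _; rewrite meval_b.
  have [<-|_] := eqVneq t u; last by rewrite mulr0 scale0r.
  (* The exponent [d - k] is positive, so this last summand vanishes too. *)
  by rewrite lt0 expr0n subn_eq0 leqNgt lt_kd scaler0.
move=> /apolar_pi_comb_eq0 invV0; have /eqP := meval_b t t.
rewrite /b big1 => [|i _]; last by rewrite invV0 scale0r.
by rewrite meval0 eqxx eq_sym oner_eq0.
Qed.

Lemma hessian_poly_power_sum_neq0 : (k.*2 <= d)%N -> hessian_poly f alpha != 0.
Proof.
move=> le_kd.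
have -> : hessian_poly f alpha = \det (map_mx (@mpolyC n.+1 K) V *m
    diag_mx (\row_t ((d ^_ k.*2)%:R *: l t ^+ (d - k.*2))) *m
    (map_mx (@mpolyC n.+1 K) V)^T).
  congr (\det _); apply/matrixP => i j.
  rewrite !mxE !alphaE -rmorphM /apolar_act diffact_repr -addnn.
  rewrite (diffact_power_sum (dhomogM (a_homog i) (a_homog j))).
  apply: eq_bigr => t _.
  rewrite mul_mx_diag !mxE mevalM -!mul_mpolyC !mpolyCM.
  by rewrite [RHS]mulrAC [RHS]mulrCA [RHS]mulrA.
rewrite !det_mulmx det_tr det_map_mx det_diag !mulf_neq0 //.
- by rewrite mpolyC_eq0 -unitfE -unitmxE eval_mx_unit.
- apply/prodf_neq0 => t _; rewrite mxE scaler_eq0 negb_or natf_ffact_neq0 //=.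
  (* If [d <= k], then [k.*2 <= d] forces [d = k = 0], and the power is 1 whatever [l t] is. *)
  have [lt_kd|le_dk] := ltnP k d; first by rewrite expf_neq0 ?linear_form_neq0.
  suff -> : (d - k.*2)%N = 0%N by rewrite expr0 oner_neq0.
  by apply/eqP; rewrite subn_eq0 (leq_trans le_dk) // -addnn leq_addr.
by rewrite mpolyC_eq0 -unitfE -unitmxE eval_mx_unit.
Qed.

Lemma exists_separating_linear_form : (k < d)%N ->
  exists2 L : {mpoly K[n.+1]}, L \is 1.-homog & forall t, L.@[p t] != 0.
Proof.
move=> lt_kd; have [t|v v_neq0] := @exists_common_nonroot K _ _ p K0.
  apply/existsP; rewrite -[X in is_true X]negbK negb_exists.
  apply/negP => /forallP pt0; have /negP := linear_form_neq0 t lt_kd; apply.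
  apply/eqP/mpolyP => m; rewrite mcoeff0.
  have [/eqP/mdeg1P[i /eqP->]|m_neq1] := eqVneq (mdeg m) 1%N.
    by apply/eqP; have := pt0 i; rewrite negbK.
  exact: dhomog_nemf_coeff (l_homog t) m_neq1.
exists (\sum_i v i *: 'X_i) => [|t].
  by apply: rpred_sum => i _; apply: rpredZ; rewrite dhomogX /= mdeg1.
rewrite rmorph_sum [X in X != 0](_ : _ = \sum_i p t i * v i) ?v_neq0 //.
by apply: eq_bigr => i _; rewrite /= mevalZ mevalXU mulrC.
Qed.

End Basis.

(** * Multiplication by a linear form nonzero at all the points *)

Section MultiplicationByForm.
Variables (k : nat) (b : 'I_s -> {mpoly K[n.+1]}) (L : {mpoly K[n.+1]}).
Hypothesis b_homog : forall t, b t \is k.-homog.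
Hypothesis meval_b : forall t u, (b t).@[p u] = (t == u)%:R.
Hypothesis L_homog : L \is 1.-homog.
Hypothesis meval_L_neq0 : forall t, L.@[p t] != 0.

Let mulL : 'End(A) := linfun ( *%R (apolar_pi f L)).

Lemma mul_form_sub i : (mulL @: apolar_piece f i <= apolar_piece f i.+1)%VS.
Proof.
apply/subvP => _ /memv_imgP[_ /apolar_pieceP[a a_homog ->] ->].
rewrite linfun_mulE -rmorphM; apply/apolar_pieceP.
by exists (L * a) => //; apply: (dhomogM L_homog a_homog).
Qed.

(* If [L * a] kills [f] then so does [b t * (L * a)], whose action on [f] is a
   nonzero multiple of [a.@[p t] *: l t ^+ (d - (k + i.+1))]. *)
Lemma mul_form_inj i : (forall t, l t != 0) -> (i <= k)%N -> (k.*2 < d)%N ->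
  \dim (mulL @: apolar_piece f i) = \dim (apolar_piece f i).
Proof.
move=> l_neq0 le_ik lt_kd; apply: limg_dim_eq; apply/eqP; rewrite -subv0.
apply/subvP => x; rewrite memv_cap memv_ker => /andP[].
move=> /apolar_pieceP[a a_homog ->]; rewrite linfun_mulE -rmorphM.
move=> /eqP/apolar_pi_eq0P La0.
have bLa_homog t := dhomogM (b_homog t) (dhomogM L_homog a_homog).
rewrite memv0; apply/eqP; apply: apolar_pi_eval_eq0 a_homog _ => t.
have: diffact (b t * (L * a)) f = 0.
  by rewrite diffactM La0 linear0.
rewrite (diffact_power_sum (bLa_homog t)) (bigD1 t) //=.
rewrite big1 => [|u ut]; last first.
  by rewrite mevalM meval_b eq_sym (negPf ut) mul0r mulr0 scale0r.
move/eqP; rewrite addr0 mevalM meval_b eqxx mul1r mevalM.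
rewrite scaler_eq0 expf_eq0 (negPf (l_neq0 t)) andbF orbF.
rewrite !mulf_eq0 (negPf (meval_L_neq0 t)) (negPf (natf_ffact_neq0 _)).
  by move=> /eqP.
(* The total degree [k + (1 + i)] is at most [k.*2.+1], hence at most [d]. *)
by rewrite (leq_trans _ lt_kd) // -addnn add1n addnS ltnS leq_add2l.
Qed.

Lemma mul_form_surj i : (k <= i)%N ->
  (mulL @: apolar_piece f i)%VS = apolar_piece f i.+1.
Proof.
move=> le_ki; apply/eqP; rewrite eqEsubv mul_form_sub /=.
apply/subvP => _ /apolar_pieceP[a a_homog ->].
(* Interpolation makes [L * a'] agree with [a] at all the points; the extra power of [L] in the
   denominator absorbs the factor [L]. *)
pose c t := a.@[p t] / (L ^+ (i - k).+1).@[p t].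
pose a' := \sum_t c t *: (b t * L ^+ (i - k)).
have a'_homog : a' \is i.-homog.
  apply: rpred_sum => t _; apply: rpredZ.
  have := dhomogM (b_homog t) (dhomogMn (i - k) L_homog).
  by rewrite mul1n subnKC.
have meval_a' t : (L * a').@[p t] = a.@[p t].
  rewrite mevalM rmorph_sum (bigD1 t) //= big1 => [|u ut]; last first.
    by rewrite mevalZ mevalM meval_b (negPf ut) mul0r mulr0.
  rewrite addr0 mevalZ mevalM meval_b eqxx mul1r mulrCA /c -rmorphM -exprS.
  by rewrite divfK // rmorphXn; apply: expf_neq0; apply: meval_L_neq0.
apply/memv_imgP; exists (apolar_pi f a').
  by apply/apolar_pieceP; exists a'.
rewrite linfun_mulE -rmorphM; apply/eqP; rewrite -subr_eq0 -linearB.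
apply/eqP/(@apolar_pi_eval_eq0 i.+1) => [|t].
  by rewrite rpredB //; apply: (dhomogM L_homog a'_homog).
by rewrite mevalB meval_a' subrr.
Qed.

(** Injectivity for [i <= k] and surjectivity for [i >= k] each decide which dimension is the
    minimum. *)
Lemma mul_form_maxrank i : (forall t, l t != 0) -> (k.*2 < d)%N ->
  mul_maxrank (apolar_pi f L) i.
Proof.
move=> l_neq0 lt_kd; rewrite /mul_maxrank -/mulL.
case/orP: (leq_total i k) => [le_ik|le_ki].
  rewrite mul_form_inj //; apply/esym/minn_idPl.
  by rewrite -mul_form_inj // dimvS ?mul_form_sub.
rewrite mul_form_surj //; apply/esym/minn_idPr.
by rewrite -mul_form_surj // -(limg_ker_dim mulL (apolar_piece f i)) leq_addl.
Qed.

End MultiplicationByForm.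

End PowerSum.

Lemma basis_of_piece_repr (K : fieldType) (n s k : nat) (f : {mpoly K[n.+1]})
    (alpha : s.-tuple (apolar_alg f)) :
  basis_of (apolar_piece f k) alpha ->
  exists2 a : 'I_s -> {mpoly K[n.+1]}, forall i, a i \is k.-homog &
    forall i, tnth alpha i = apolar_pi f (a i).
Proof.
move=> alpha_basis.
have /fin_all_exists2[a] i : exists2 a : {mpoly K[n.+1]},
    a \is k.-homog & tnth alpha i = apolar_pi f a.
  by apply/apolar_pieceP; rewrite (basis_mem alpha_basis) ?mem_tnth.
by exists a.
Qed.

Theorem corollary2p5 (R : realType) (n d s k : nat)
    (f : {mpoly R[i][n.+1]}) (l : 'I_s -> {mpoly R[i][n.+1]}) :
  f \is d.-homog ->
  (forall j, l j \is 1.-homog) ->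
  f = \sum_(j < s) l j ^+ d ->
  (k.*2 <= d)%N ->
  s = \dim (apolar_piece f k) ->
  (forall alpha : (\dim (apolar_piece f k)).-tuple (apolar_alg f),
      basis_of (apolar_piece f k) alpha -> hessian_poly f alpha != 0) /\
  (forall q : nat, d = q.*2.+1 -> k = q -> weak_lefschetz f d).
Proof.
move=> _ l_homog -> le_kd s_dim.
have K0 : has_char0 R[i] := Num.Theory.pchar_num _.
(* The tuple type of the basis mentions the dimension, so the basis is generalized before [s]
   replaces it. *)
move: (vbasis _) (vbasisP (apolar_piece (\sum_(j < s) l j ^+ d) k)).
rewrite -s_dim => beta beta_basis; split=> [alpha alpha_basis|q dE kq].
  have [a a_homog alphaE] := basis_of_piece_repr alpha_basis.
  have alpha_free := basis_free alpha_basis.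
  exact: (hessian_poly_power_sum_neq0 K0 l_homog alpha_free a_homog).
have lt_kd : (k.*2 < d)%N by rewrite dE kq.
have lt_k : (k < d)%N by apply: leq_ltn_trans lt_kd; rewrite -addnn leq_addr.
have [a a_homog betaE] := basis_of_piece_repr beta_basis.
have beta_free := basis_free beta_basis.
have [b b_homog meval_b] := exists_dual_forms l_homog beta_free a_homog betaE.
have [L L_homog meval_L] :=
  exists_separating_linear_form K0 l_homog beta_free a_homog betaE lt_k.
exists (apolar_pi _ L) => [|i _]; first by apply/apolar_pieceP; exists L.
apply: (mul_form_maxrank K0 l_homog b_homog meval_b L_homog meval_L) => // t.
exact: (linear_form_neq0 l_homog beta_free a_homog betaE).
Qed.
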